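(* Let $m\geq1$, let $\mathcal{X},\mathcal{Y}^1,\dots,\mathcal{Y}^m$ be $\mathcal{C}^\infty$-smooth functions of $(x,y^1,\dots,y^m)\in\mathbb{K}^{1+m}$, and let $\mathbf{Y}_\kappa^j$ be the coefficients of the prolongations of the vector field $\mathcal{X}\frac{\partial}{\partial x}+\sum_{j=1}^m\mathcal{Y}^j\frac{\partial}{\partial y^j}$, as defined in the context. For every $\kappa\geq1$ and every $j\in\{1,\dots,m\}$, $$ \begin{aligned} \mathbf{Y}_\kappa^j &=\frac{\partial^\kappa\mathcal{Y}^j}{\partial x^\kappa} +\sum_{d=1}^{\kappa+1}\ \sum_{1\leq\lambda_1<\cdots<\lambda_d\leq\kappa}\ \sum_{\substack{\mu_1\geq1,\dots,\mu_d\geq1\\ \mu_1\lambda_1+\cdots+\mu_d\lambda_d\leq\kappa+1}}\ \sum_{l_{1:1},\dots,l_{1:\mu_1}=1}^m\cdots\sum_{l_{d:1},\dots,l_{d:\mu_d}=1}^m\\ &\frac{\kappa(\kappa-1)\cdots(\kappa-M+2)}{(\lambda_1!)^{\mu_1}\,\mu_1!\cdots(\lambda_d!)^{\mu_d}\,\mu_d!} \Bigg[(\kappa-M+1)\,\frac{\partial^{\kappa-M+p}\,\mathcal{Y}^j}{(\partial x)^{\kappa-M}\,\partial y^{l_{1:1}}\cdots\partial y^{l_{1:\mu_1}}\cdots\partial y^{l_{d:1}}\cdots\partial y^{l_{d:\mu_d}}}\\ &\quad-\sum_{e=1}^d\delta_{l_{e:1}}^j\,\mu_e\lambda_e\, \frac{\partial^{\kappa-M+p}\,\mathcal{X}}{(\partial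 x)^{\kappa-M+1}\,\partial y^{l_{1:1}}\cdots\partial y^{l_{1:\mu_1}}\cdots\widehat{\partial y^{l_{e:1}}}\cdots\partial y^{l_{d:1}}\cdots\partial y^{l_{d:\mu_d}}}\Bigg]\\ &\cdot\prod_{1\leq\nu_1\leq\mu_1}y_{\lambda_1}^{l_{1:\nu_1}}\ \cdots\prod_{1\leq\nu_d\leq\mu_d}y_{\lambda_d}^{l_{d:\nu_d}}, \end{aligned} $$ where, in each term, $M:=\mu_1\lambda_1+\cdots+\mu_d\lambda_d$ and $p:=\mu_1+\cdots+\mu_d$, and where $\widehat{\partial y^{l_{e:1}}}$ means that this single partial derivative is omitted from the list of the $p$ derivatives $\partial y^{l_{1:1}},\dots,\partial y^{l_{d:\mu_d}}$.
   Context: $\mathbb{K}=\mathbb{R}$ or $\mathbb{C}$. One independent variable $x$, dependent variables $y^1,\dots,y^m$. The jet variables $x,y^j,y_1^j,y_2^j,\dots,y_\kappa^j$ ($1\leq j\leq m$) are independent coordinates ($y_\lambda^j$ corresponds to $d^\lambda y^j/dx^\lambda$). The total differentiation operators are $$D^\lambda:=\frac{\partial}{\partial x}+\sum_{l=1}^my_1^l\frac{\partial}{\partial y^l}+\sum_{l=1}^my_2^l\frac{\partial}{\partial y_1^l}+\cdots+\sum_{l=1}^my_\lambda^l\frac{\partial}{\partial y_{\lambda-1}^l}.$$ The $\kappa$-th prolongation of the vector field is $\mathcal{X}\,\partial_x+\sum_j\mathcal{Y}^j\,\partial_{y^j}+\sum_j\mathbf{Y}_1^j\,\partial_{y_1^j}+\cdots+\sum_j\mathbf{Y}_\kappa^j\,\partial_{y_\kappa^j}$,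 with coefficients defined inductively by $$\mathbf{Y}_1^j:=D^1(\mathcal{Y}^j)-D^1(\mathcal{X})\,y_1^j,\qquad\mathbf{Y}_\lambda^j:=D^\lambda(\mathbf{Y}_{\lambda-1}^j)-D^1(\mathcal{X})\,y_\lambda^j\quad(\lambda\geq2).$$ The $\lambda_e,\mu_e$ are integers; $l_{e:\nu}$ ($1\leq e\leq d$, $1\leq\nu\leq\mu_e$) are summation indices in $\{1,\dots,m\}$; $\delta_l^j$ is the Kronecker symbol. The product $\kappa(\kappa-1)\cdots(\kappa-M+2)$ has $M-1$ factors (equal to $1$ if $M=1$). When $M=\kappa+1$ the term in $\mathcal{Y}^j$, which carries the factor $\kappa-M+1=0$, is understood to be $0$. *)

(* Defs.v *)
From HB Require Import structures.
From mathcomp Require Import all_boot all_order all_algebra.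
From mathcomp Require Import all_classical all_reals all_analysis.
From mathcomp Require Import complex.
Import Order.TTheory GRing.Theory Num.Theory.
Import numFieldNormedType.Exports.

Set Implicit Arguments.
Unset Strict Implicit.
Unset Printing Implicit Defensive.

Local Open Scope ring_scope.

(* A point of K^(1+m) is a row vector: entry 0 is x, entry 1 + l is y^l.
   Derivatives are taken over K, so for K = R[i] they are complex ones. *)
Section Partials.
Variables (K : numFieldType) (m : nat).
Implicit Type f : 'rV[K]_(1 + m) -> K.

Definition partial (i : 'I_(1 + m)) f : 'rV[K]_(1 + m) -> K :=
  fun a => 'D_(delta_mx 0 i) f a.

Fixpoint is_Ck (k : nat) f : Prop :=
  match k with
  | 0%N => continuous f
  | k'.+1 => [/\ continuous f,
                 forall i a, derivable f a (delta_mx 0 i)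
               & forall i, is_Ck k' (partial i f)]
  end.

Definition smooth f : Prop := forall k, is_Ck k f.

Definition partial_x f := partial (lshift m ord0) f.
Definition partial_y (l : 'I_m) f := partial (rshift 1 l) f.

(* d^(a + r) f / (dx)^a dy^{l_1} ... dy^{l_r}  for  ls = [:: l_1; ...; l_r] *)
Definition mixed_partial (a : nat) (ls : seq 'I_m) f :=
  iter a partial_x (foldr partial_y f ls).

End Partials.

(* Jets of infinite order: jet_y J k l is the coordinate y_k^l, with
   y_0^l = y^l.  The k-th prolongation only involves the coordinates of order
   at most k, so working here avoids the pullbacks between finite jet spaces. *)
Record jet (K : numFieldType) (m : nat) :=
  Jet { jet_x : K ; jet_y : nat -> 'I_m -> K }.

Section Prolongation.
Variables (K : numFieldType) (m : nat).
Implicit Types (J : jet K m) (F : jet K m -> K).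

Definition jet_base J : 'rV[K]_(1 + m) :=
  row_mx (const_mx (jet_x J)) (\row_l jet_y J 0 l).

Definition set_jet_x J (t : K) : jet K m := Jet t (jet_y J).

Definition set_jet_y J (k : nat) (l : 'I_m) (t : K) : jet K m :=
  Jet (jet_x J)
      (fun k' l' => if (k' == k) && (l' == l) then t else jet_y J k' l').

(* Partial derivatives of F along the coordinate x, resp. y_k^l *)
Definition djet_x F : jet K m -> K :=
  fun J => derive1 (fun t => F (set_jet_x J t)) (jet_x J).

Definition djet_y (k : nat) (l : 'I_m) F : jet K m -> K :=
  fun J => derive1 (fun t => F (set_jet_y J k l t)) (jet_y J k l).

Definition total_D (lambda : nat) F : jet K m -> K :=
  fun J => djet_x F J
    + \sum_(i < lambda) \sum_(l < m) jet_y J i.+1 l * djet_y i l F J.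

(* prolongation_coef X Y j k is the coefficient of d/dy_k^j, that of order 0
   being Y^j *)
Fixpoint prolongation_coef (X : 'rV[K]_(1 + m) -> K)
    (Y : 'I_m -> 'rV[K]_(1 + m) -> K) (j : 'I_m) (k : nat) : jet K m -> K :=
  match k with
  | 0%N => fun J => Y j (jet_base J)
  | k'.+1 => fun J =>
      total_D k'.+1 (prolongation_coef X Y j k') J
      - total_D 1 (fun J' => X (jet_base J')) J * jet_y J k'.+1 j
  end.

End Prolongation.

Section Indices.
Variables (kappa d : nat).
Implicit Types (lambda : {ffun 'I_d -> 'I_kappa.+1})
               (mu : {ffun 'I_d -> 'I_kappa.+2}).

Definition weight lambda mu : nat := (\sum_(e < d) mu e * lambda e)%N.

(* 1 <= lambda_1 < ... < lambda_d <= kappa *)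
Definition lambda_ok lambda : bool :=
  [forall e, 0 < lambda e]%N &&
  [forall e1 : 'I_d, forall e2 : 'I_d,
     (e1 < e2)%N ==> (lambda e1 < lambda e2)%N].

(* The bound mu_e <= kappa + 1 built into the type of mu follows from
   the last condition. *)
Definition mu_ok lambda mu : bool :=
  [forall e, 0 < mu e]%N && (weight lambda mu <= kappa.+1)%N.

(* The labels e:nu of the indices l_{e:nu}, both e and nu counted from 0 *)
Definition label mu (e : 'I_d) (nu : 'I_(mu e)) : {e : 'I_d & 'I_(mu e)} :=
  Tagged (fun e => 'I_(mu e)) nu.

End Indices.

(* Main.v *)
Require Import Defs.
From HB Require Import structures.
From mathcomp Require Import all_boot all_order all_algebra.
From mathcomp Require Import all_classical all_reals all_analysis.
From mathcomp Require Import complex.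
From mathcomp Require Import ring zify.
Import Order.TTheory GRing.Theory Num.Theory.
Import numFieldNormedType.Exports.
Set Implicit Arguments.
Unset Strict Implicit.
Unset Printing Implicit Defensive.
Local Open Scope ring_scope.

(** Write [D] for the total derivative.  By induction on [q], with Pascal's
    rule, the prolongation coefficient of order [q] is
      [D^q Y^j - \sum_(i < q) 'C(q, i) y_(i+1)^j D^(q-i) X].
    Iterating Leibniz' rule on [D f = f_x + \sum_l y_1^l f_(y^l)] gives
      [D^(q+1) f = D^q f_x + \sum_i 'C(q, i) \sum_l y_(i+1)^l D^(q-i) f_(y^l)],
    a recursion which is solved by the Faa di Bruno sum
      [D^q f = \sum_n q! / ((q - M)! \prod_k k!^(n_k) n_k!) A^n dx^(q-M) f]
    over multiplicity functions [n] with [M = \sum_k k n_k <= q], where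
    [A_k = \sum_l y_k^l d/dy^l] with frozen [y_k^l].  In both places, summing
    over a part [k] and a function [n'] amounts to summing over [n = n' + 1_k]
    and over [k] with [n_k > 0].  Finally [n] is encoded by its support
    [lambda_1 < ... < lambda_d] and the multiplicities [mu_e = n_(lambda_e)].
    Reordering the derivatives rests on the symmetry of second derivatives,
    obtained over [R[i]] from the real case by restricting to real lines and
    taking real and imaginary parts. *)

(** * Symmetry of second derivatives *)

Section RealSchwarz.
Local Open Scope classical_set_scope.
Local Open Scope ring_scope.
Variable R : realType.
Implicit Types (g gs gt gst gts : R -> R -> R) (h : R).

(** The mean value theorem, applied to [s |-> g s h - g s 0] and then to [gs c], expresses the
    second difference over a square of side [h] by one value of the mixed derivative. *)
Lemma second_difference g gs gst h : 0 < h ->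
    (forall s t : R, is_derive s 1 (g ^~ t) (gs s t)) ->
    (forall s t : R, is_derive t 1 (gs s) (gst s t)) ->
  exists p : R * R, [/\ 0 < p.1 < h, 0 < p.2 < h &
    g h h - g h 0 - (g 0 h - g 0 0) = gst p.1 p.2 * h ^+ 2].
Proof.
move=> h0 dg dgs.
pose u s := g s h - g s 0.
have du (s : R) : is_derive s 1 u (gs s h - gs s 0).
  by apply: (@is_deriveB _ _ _ (g ^~ h) (g ^~ 0)).
have cont (f df : R -> R) : (forall s : R, is_derive s 1 f (df s)) ->
    {within `[0, h], continuous f}.
  by move=> dfP; apply: derivable_within_continuous => s _; have [] := dfP s.
have [c] := MVT h0 (fun s _ => du s) (cont _ _ du).
rewrite in_itv /= => hc; rewrite subr0 => eu.
have [d] := MVT h0 (fun t _ => dgs c t) (cont _ _ (dgs c)).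
rewrite in_itv /= => hd; rewrite subr0 => egs.
exists (c, d); split => //=.
by rewrite expr2 mulrA -egs -eu.
Qed.

(** The second difference is symmetric in the two variables, so [gst] and [gts] share a value, each
    at its own point of an arbitrarily small square; continuity at the origin concludes. *)
Lemma real_Schwarz g gs gt gst gts :
    (forall s t : R, is_derive s 1 (g ^~ t) (gs s t)) ->
    (forall s t : R, is_derive t 1 (gs s) (gst s t)) ->
    (forall s t : R, is_derive t 1 (g s) (gt s t)) ->
    (forall s t : R, is_derive s 1 (gt ^~ t) (gts s t)) ->
    {for (0, 0), continuous (fun p : R * R => gst p.1 p.2)} ->
    {for (0, 0), continuous (fun p : R * R => gts p.1 p.2)} ->
  gst 0 0 = gts 0 0.
Proof.
move=> dg dgs dg' dgt cst cts.
apply/eqP; rewrite -subr_eq0 -normr_le0; apply/ler_addgt0Pr => e e0; rewrite add0r.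
have e2 : 0 < e / 2 by rewrite divr_gt0.
move/cvgrPdist_lt/(_ _ e2)/nbhs_ballP : cst => [d1 /= d10 H1].
move/cvgrPdist_lt/(_ _ e2)/nbhs_ballP : cts => [d2 /= d20 H2].
pose h := Num.min d1 d2.
have h0 : 0 < h by rewrite lt_min d10.
have [p [p1 p2 ep]] := second_difference h0 dg dgs.
(* The variables are exchanged here: [q.1] is a value of [t] and [q.2] a value of [s]. *)
have [q [q1 q2 eq]] := @second_difference (fun s t => g t s) (fun s t => gt t s)
  (fun s t => gts t s) _ h0 (fun s t => dg' t s) (fun s t => dgt t s).
have inb (c d : R) : 0 < c < h -> d1 >= h /\ d2 >= h -> 0 < d < h ->
    ball (0 : R, 0 : R) d1 (c, d) /\ ball (0 : R, 0 : R) d2 (c, d).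
  move=> /andP[c0 ch] [hd1 hd2] /andP[dd0 dh].
  by split; split; rewrite /ball /= sub0r normrN gtr0_norm //;
    apply: lt_le_trans hd1 || apply: lt_le_trans hd2.
have hh : d1 >= h /\ d2 >= h by split; rewrite ge_min lexx ?orbT.
have eqpq : gst p.1 p.2 = gts q.2 q.1.
  apply: (mulIf (x := h ^+ 2)); first by rewrite expf_neq0 ?gt_eqF.
  by rewrite -ep -eq; ring.
have {}H1 := H1 _ (inb _ _ p1 hh p2).1.
have {}H2 := H2 _ (inb _ _ q2 hh q1).2.
rewrite /= in H1 H2 eqpq.
rewrite [e]splitr -(subrKA (gts q.2 q.1)) (le_trans (ler_normD _ _)) //.
by apply: lerD; apply: ltW; [rewrite -eqpq | rewrite distrC].
Qed.

End RealSchwarz.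

(** * Reduction of the symmetry over [K] to real functions of real variables *)

Section RealFunctionals.
Local Open Scope classical_set_scope.
Local Open Scope ring_scope.
Variables (R : realType) (K : numFieldType) (iota : {rmorphism R -> K}).

Record real_functional (phi : K -> R) : Prop := RealFunctional {
  rf_continuous : continuous phi;
  rf_sub : forall z w, phi (z - w) = phi z - phi w;
  rf_scale : forall r z, phi (iota r * z) = r * phi z }.

(* Allows a [K]-valued identity to be checked on real-valued functions of real
   variables: for [K = R[i]], [phi] ranges over [Re] and [Im]. *)
Definition real_separated : Prop := continuous iota /\
  forall z, (forall phi, real_functional phi -> phi z = 0) -> z = 0.

Variable V : normedModType K.

(** [phi] is additive, continuous and commutes with real scalars, so it passes through the
    difference quotients and their limit. *)
Lemma is_derive_real_line (phi : K -> R) (F : V -> K) (a u : V) (s : R) :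
    continuous iota -> real_functional phi ->
    derivable F (a + iota s *: u) u ->
  is_derive s 1 (fun r : R => phi (F (a + iota r *: u)))
    (phi ('D_u F (a + iota s *: u))).
Proof.
move=> ci [cphi phiB phiZ] dF; set b := a + _.
(* A field morphism is injective, so nonzero real increments stay nonzero in [K]. *)
have iota0 : iota h @[h --> 0^'] --> (0 : K)^'.
  move=> A HA; have := ci 0 (fun z => z != 0 -> A z); rewrite rmorph0 => /(_ HA) HA'.
  change (nbhs (0 : R) (fun h => h != 0 -> A (iota h))).
  near=> h => h0.
  have : (fun z => z != 0 -> A z) (iota h) by near: h; exact: HA'.
  by apply; rewrite fmorph_eq0.
have lim_phi : phi ((iota h)^-1 *: ((F \o shift b) (iota h *: u) - F b)) @[h --> 0^']
    --> phi ('D_u F b).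
  apply: continuous_cvg; first exact: cphi.
  exact: (cvg_comp _ _ iota0 dF).
have quotE : (fun h : R => h^-1 *: (((fun r => phi (F (a + iota r *: u))) \o shift s)
      (h *: 1) - phi (F (a + iota s *: u)))) =
    (fun h => phi ((iota h)^-1 *: ((F \o shift b) (iota h *: u) - F b))).
  apply/funext => h /=; rewrite /= [in RHS]/GRing.scale /= -fmorphV phiZ phiB.
  by rewrite /b addrCA -scalerDl -rmorphD [h *: 1]mulr1.
apply: DeriveDef.
  by rewrite /derivable quotE; apply: cvgP lim_phi.
by rewrite /derive quotE; apply: cvg_lim.
Unshelve. all: by end_near. Qed.

(** Each [phi] reduces the claim to [real_Schwarz] for [phi \o f] on the real plane through [a] with
    directions [u] and [v]. *)
Lemma derive_comm (f : V -> K) (u v a : V) : real_separated ->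
    (forall b, derivable f b u) -> (forall b, derivable f b v) ->
    (forall b, derivable ('D_u f) b v) -> (forall b, derivable ('D_v f) b u) ->
    continuous ('D_v ('D_u f)) -> continuous ('D_u ('D_v f)) ->
  'D_v ('D_u f) a = 'D_u ('D_v f) a.
Proof.
move=> [ci sep] du dv duv dvu cuv cvu.
apply/eqP; rewrite -subr_eq0; apply/eqP/sep => phi hphi.
rewrite (rf_sub hphi); apply/eqP; rewrite subr_eq0; apply/eqP.
pose b s t : V := a + iota s *: u + iota t *: v.
have bC s t : b s t = a + iota t *: v + iota s *: u by rewrite /b addrAC.
have b0 : b 0 0 = a by rewrite /b rmorph0 !scale0r !addr0.
have cb : continuous (fun p : R * R => b p.1 p.2).
  move=> p; apply: cvgD; first apply: cvgD; first exact: cvg_cst.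
    by apply: cvgZr_tmp; apply: (@continuous_comp _ _ _ fst iota); [exact: cvg_fst | exact: ci].
  by apply: cvgZr_tmp; apply: (@continuous_comp _ _ _ snd iota); [exact: cvg_snd | exact: ci].
have cphi (G : V -> K) : continuous G ->
    {for (0, 0), continuous (fun p : R * R => phi (G (b p.1 p.2)))}.
  move=> cG; apply: (@continuous_comp _ _ _ (fun p : R * R => G (b p.1 p.2)) phi).
    by apply: (@continuous_comp _ _ _ (fun p : R * R => b p.1 p.2) G); [exact: cb | exact: cG].
  exact: (rf_continuous hphi).
rewrite -b0; apply: (@real_Schwarz R (fun s t => phi (f (b s t)))
  (fun s t => phi ('D_u f (b s t))) (fun s t => phi ('D_v f (b s t)))
  (fun s t => phi ('D_v ('D_u f) (b s t))) (fun s t => phi ('D_u ('D_v f) (b s t)))).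
- move=> s t; rewrite bC; under eq_fun => r do rewrite bC.
  exact: is_derive_real_line.
- by move=> s t; apply: is_derive_real_line.
- by move=> s t; apply: is_derive_real_line.
- move=> s t; rewrite bC; under eq_fun => r do rewrite bC.
  exact: is_derive_real_line.
- exact: (cphi _ cuv).
- exact: (cphi _ cvu).
Qed.

End RealFunctionals.

Lemma real_separated_id (R : realType) :
  real_separated (idfun : {rmorphism R -> R}).
Proof.
split; first by move=> x; exact: cvg_id.
by move=> z; apply; split => // x; exact: cvg_id.
Qed.

Section ComplexFunctionals.
Variable R : realType.
Let C : numFieldType := R[i]%C.

(** The norm bound makes a real-linear map 1-Lipschitz, hence continuous. *)
Lemma real_functional_of_contraction (phi : C -> R) :
    (forall z w, phi (z - w) = phi z - phi w) ->
    (forall r z, phi (r%:C%C * z) = r * phi z) ->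
    (forall z, (`|phi z|%:C)%C <= `|z|) ->
  real_functional (real_complex R) phi.
Proof.
move=> phiB phiZ phi_le; split=> // z; apply/(@cvgrPdist_lt _ _ _ (nbhs (z : C)) _) => e e0.
have e0' : 0 < (e%:C%C : C) by rewrite ltcR.
near=> w; rewrite -phiB -ltcR; apply: le_lt_trans (phi_le _) _.
by near: w; by apply/nbhs_ballP; exists (e%:C)%C.
Unshelve. all: by end_near. Qed.

Lemma real_separated_complex :
  @real_separated R C (real_complex R).
Proof.
split.
  move=> x; apply/(@cvgrPdist_lt C) => e e0.
  (* A positive element of [R[i]] is real, so its real part serves as the radius. *)
  have eE : e = ((complex.Re e)%:C)%C by rewrite RRe_real // gtr0_real.
  have e0' : 0 < complex.Re e by rewrite -ltcR -eE.
  near=> t; rewrite -rmorphB normc_def /= expr0n addr0 sqrtr_sqr eE ltcR.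
  by near: t; by apply/nbhs_ballP; exists (complex.Re e).
move=> z hz; apply/eqP; rewrite eq_complex; apply/andP; split; apply/eqP.
- apply: hz; apply: real_functional_of_contraction => [z1 w|r z1|z1].
  + by rewrite raddfB.
  + by case: z1 => a b /=; rewrite mul0r subr0.
  + exact: normc_ge_Re.
- apply: hz; apply: real_functional_of_contraction => [z1 w|r z1|z1].
  + by rewrite raddfB.
  + by case: z1 => a b /=; rewrite mul0r addr0.
  + by rewrite normc_def lecR -sqrtr_sqr ler_wsqrtr // lerDr sqr_ge0.
Unshelve. all: by end_near. Qed.

End ComplexFunctionals.

Section SmoothFunctions.
Variables (R : realType) (K : numFieldType) (iota : {rmorphism R -> K}).
Hypothesis iotaP : real_separated iota.
Variable m : nat.
Implicit Types (f : 'rV[K]_(1 + m) -> K) (i k : 'I_(1 + m)) (l : 'I_m).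

Lemma smooth_derivable f i a : smooth f -> derivable f a (delta_mx 0 i).
Proof. by move=> /(_ 1) [_ /(_ i a)]. Qed.

Lemma smooth_continuous f : smooth f -> continuous f.
Proof. by move=> /(_ 0). Qed.

Lemma smooth_partial f i : smooth f -> smooth (partial i f).
Proof. by move=> sf k; have [_ _ /(_ i)] := sf k.+1. Qed.

Lemma partialC f i k : smooth f ->
  partial i (partial k f) = partial k (partial i f).
Proof.
move=> sf; apply/funext => a; apply: (derive_comm _ iotaP) => [b|b|b|b| |].
- exact: smooth_derivable.
- exact: smooth_derivable.
- by apply: smooth_derivable; exact: smooth_partial.
- by apply: smooth_derivable; exact: smooth_partial.
- by apply: smooth_continuous; do 2 apply: smooth_partial.
- by apply: smooth_continuous; do 2 apply: smooth_partial.
Qed.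

End SmoothFunctions.

(** * Jet polynomials and multiplicity functions *)

Definition partials_commute (K : numFieldType) (m : nat) : Prop :=
  forall (f : 'rV[K]_(1 + m) -> K) i k, smooth f ->
    partial i (partial k f) = partial k (partial i f).

Section JetPolarization.
Variables (K : numFieldType) (m : nat).
Hypothesis comm_partial : partials_commute K m.
Implicit Types (f : 'rV[K]_(1 + m) -> K) (J : jet K m) (ks : seq nat).

(* The value at [J] of [A_(k_1) ... A_(k_p) f], where the coordinates [y_k^l] in
   [A_k = \sum_l y_k^l d/dy^l] are treated as constants. *)
Fixpoint jet_polar ks f J : K :=
  if ks is k :: ks' then \sum_(l < m) jet_y J k l * jet_polar ks' (partial_y l f) J
  else f (jet_base J).

(** With frozen jet coordinates the operators [A_k] commute as soon as the partial derivatives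
    do. *)
Lemma jet_polar_catC k ks1 ks2 f J : smooth f ->
  jet_polar (ks1 ++ k :: ks2) f J = jet_polar (k :: ks1 ++ ks2) f J.
Proof.
elim: ks1 f => //= k1 ks1 IH f sf.
under eq_bigr => l1 _ do (rewrite IH /=; last exact: smooth_partial).
under eq_bigr => l1 _ do rewrite big_distrr /=.
rewrite exchange_big /=; apply: eq_bigr => l _; rewrite big_distrr /=.
by apply: eq_bigr => l1 _; rewrite mulrCA /partial_y (comm_partial (rshift 1 l) _ sf).
Qed.

Lemma jet_polar_perm ks ks' f J : smooth f -> perm_eq ks ks' ->
  jet_polar ks f J = jet_polar ks' f J.
Proof.
elim: ks ks' f => [|k ks IH] ks' f sf.
  by rewrite perm_sym => /perm_nilP ->.
move=> pks; have : k \in ks' by rewrite -(perm_mem pks) mem_head.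
move: pks => /[swap] /splitPr [ks1 ks2] pks.
rewrite jet_polar_catC //=; apply: eq_bigr => l _; congr (_ * _).
apply: IH; first exact: smooth_partial.
by move: pks; rewrite perm_sym -cat1s perm_catCA perm_cons perm_sym.
Qed.

Lemma smooth_iter_x a f : smooth f -> smooth (iter a (@partial_x K m) f).
Proof. by move=> sf; elim: a => //= a; exact: smooth_partial. Qed.

Lemma iter_x_partial_y a l f : smooth f ->
  iter a (@partial_x K m) (partial_y l f) = partial_y l (iter a (@partial_x K m) f).
Proof.
move=> sf; elim: a => //= a ->.
by apply: comm_partial; exact: smooth_iter_x.
Qed.

End JetPolarization.

(** * Multiplicity functions and the shift [n = n' + 1_k] *)

Section Multiplicities.
Variables N B : nat.
Notation mults := {ffun 'I_N.+1 -> 'I_B.+1}.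
Implicit Types (n : mults) (k : 'I_N.+1).

(* [n k] is the multiplicity of the part [k].  Bounding it by [B] makes the
   type finite; [mult_add] and [mult_sub] are only meaningful away from the
   bounds, and the part [0] is excluded by the condition [n ord0 == 0]. *)
Definition mult_wt n : nat := (\sum_(k < N.+1) n k * k)%N.

Definition mult_denom n : nat := (\prod_(k < N.+1) (k`! ^ n k * (n k)`!))%N.

Definition mult_parts n : seq nat :=
  flatten [seq nseq (n k) (k : nat) | k : 'I_N.+1 <- index_enum 'I_N.+1].

Definition mult_add k n : mults :=
  [ffun i => if i == k then inord (n i).+1 else n i].

Definition mult_sub k n : mults :=
  [ffun i => if i == k then inord (n i).-1 else n i].

Lemma mult_subk k n : mult_sub k n k = (n k).-1 :> nat.
Proof. by rewrite ffunE eqxx inordK // (leq_ltn_trans (leq_pred _)). Qed.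

Lemma mult_subNk k n i : i != k -> mult_sub k n i = n i.
Proof. by rewrite ffunE => /negPf ->. Qed.

Lemma mult_addK k n : (n k < B)%N -> mult_sub k (mult_add k n) = n.
Proof.
move=> nk; apply/ffunP => i; rewrite !ffunE; case: eqP => // ->.
by apply: val_inj; rewrite /= !inordK //= ltnW.
Qed.

Lemma mult_subK k n : (0 < n k)%N -> mult_add k (mult_sub k n) = n.
Proof.
move=> nk; apply/ffunP => i; rewrite !ffunE; case: eqP => // ->.
apply: val_inj; rewrite /= (inordK (m := (n k).-1)).
  by rewrite inordK prednK // ltn_ord.
by rewrite (leq_ltn_trans (leq_pred _)).
Qed.

Lemma mult_add_gt0 k n : (n k < B)%N -> (0 < mult_add k n k)%N.
Proof. by move=> nk; rewrite ffunE eqxx inordK. Qed.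

(** The weight is left general: [w k = k] gives [mult_wt], the indicator of a predicate gives the
    counts of [mult_parts]. *)
Lemma mult_sum_sub (w : 'I_N.+1 -> nat) k n : (0 < n k)%N ->
  (\sum_i n i * w i = w k + \sum_i mult_sub k n i * w i)%N.
Proof.
move=> nk; rewrite (bigD1 k) //= [in RHS](bigD1 k) //= mult_subk addnA -mulSn prednK //.
by congr (_ + _)%N; apply: eq_bigr => i ik; rewrite mult_subNk.
Qed.

Lemma mult_wt_sub k n : (0 < n k)%N -> mult_wt n = (k + mult_wt (mult_sub k n))%N.
Proof. exact: mult_sum_sub. Qed.

Lemma count_mult_parts (p : pred nat) n :
  count p (mult_parts n) = (\sum_(k : 'I_N.+1) n k * p k)%N.
Proof.
rewrite count_flatten sumnE !big_map.
by apply: eq_bigr => k _; rewrite count_nseq mulnC.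
Qed.

Lemma mult_parts_sub k n : (0 < n k)%N ->
  perm_eq (mult_parts n) ((k : nat) :: mult_parts (mult_sub k n)).
Proof. by move=> nk; apply/permP => p /=; rewrite !count_mult_parts (mult_sum_sub _ nk). Qed.

Lemma mult_denom_gt0 n : (0 < mult_denom n)%N.
Proof. by apply: prodn_gt0 => k; rewrite muln_gt0 expn_gt0 !fact_gt0. Qed.

Lemma mult_denom_sub k n : (0 < n k)%N ->
  mult_denom n = (k`! * n k * mult_denom (mult_sub k n))%N.
Proof.
move=> nk; rewrite /mult_denom (bigD1 k) //= [in RHS](bigD1 k) //= mult_subk !mulnA.
congr (_ * _)%N; last by apply: eq_bigr => i ik; rewrite mult_subNk.
case: (n k : nat) nk => //= a _; rewrite expnS factS; lia.
Qed.

Lemma le_mult_wt k n : (n k * k <= mult_wt n)%N.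
Proof. by rewrite /mult_wt (bigD1 k) //= leq_addr. Qed.

(** A part [k > 0] in use adds at least [k] to the weight; the part [0] adds nothing and needs its
    own condition. *)
Lemma mult_wt_eq0 n :
  (n ord0 == 0 :> nat) && (mult_wt n == 0)%N = (n == [ffun=> ord0]).
Proof.
apply/andP/eqP => [[n0 /eqP wn]|->]; last first.
  by rewrite ffunE /mult_wt big1 // => k _; rewrite ffunE.
apply/ffunP => k; rewrite ffunE; apply: val_inj => /=.
have [->|k0] := eqVneq k ord0; first exact/eqP.
have k1 : (0 < k)%N by rewrite lt0n.
by have := le_mult_wt k n; rewrite wn; nia.
Qed.

Lemma mult_wt0 : mult_wt [ffun=> ord0] = 0%N.
Proof. by rewrite /mult_wt big1 // => k _; rewrite ffunE. Qed.

Lemma mult_denom0 : mult_denom [ffun=> ord0] = 1%N.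
Proof. by rewrite /mult_denom big1 // => k _; rewrite ffunE. Qed.

Lemma mult_parts0 : mult_parts [ffun=> ord0] = [::].
Proof.
apply/nilP; rewrite /nilp -count_predT count_mult_parts.
by rewrite big1 // => k _; rewrite ffunE.
Qed.

(** Change of variables [n = n' + 1_k]. As [k >= 1], the bound [T <= B] forces [n' k < B], so
    [mult_add] stays within range. *)
Lemma sum_mult_shift (A : nmodType) (G : 'I_N.+1 -> mults -> A) T :
    (0 < B)%N -> (T <= B)%N ->
  \sum_(k : 'I_N.+1 | (0 < k)%N)
    \sum_(n : mults | (n ord0 == 0 :> nat) && (k + mult_wt n <= T)%N) G k n
  = \sum_(n : mults | (n ord0 == 0 :> nat) && (mult_wt n <= T)%N)
      \sum_(k : 'I_N.+1 | (0 < k)%N && (0 < n k)%N) G k (mult_sub k n).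
Proof.
move=> B0 TB; rewrite [RHS](exchange_big_dep (fun k : 'I_N.+1 => (0 < k)%N)) /=; last first.
  by move=> n k _ /andP[].
apply: eq_bigr => k k0.
rewrite (reindex_onto (mult_sub k) (mult_add k)) /=; last first.
  move=> n /andP[_ nT]; apply: mult_addK.
  apply: leq_trans (leq_trans nT TB).
  have := le_mult_wt k n; nia.
apply: eq_bigl => n; rewrite k0 /=.
(* If [n k = 0], the predecessor is truncated, [mult_add k (mult_sub k n)] differs from [n], and the
   reindexing skips [n]. *)
have [nk|] := posnP (n k); last first.
  move=> nk; rewrite mult_subK // eqxx !andbT -mult_wt_sub // mult_subNk //.
  by rewrite -val_eqE /= neq_ltn k0.
rewrite andbF; apply/negP => /andP[_ /eqP /(congr1 (fun n : mults => n k : nat))].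
rewrite nk => e; have := @mult_add_gt0 k (mult_sub k n).
by rewrite mult_subk nk e => /(_ B0).
Qed.

End Multiplicities.

(** * The Faa di Bruno sum *)

Lemma ffact_addr q a b : (q ^_ (a + b) = q ^_ a * (q - a) ^_ b)%N.
Proof.
elim: a q => [|a IH] q; first by rewrite subn0 mul1n.
by rewrite addSn !ffactnS IH mulnA; congr (_ * _ ^_ _)%N; lia.
Qed.

Section FaaDiBruno.
Variables (K : numFieldType) (m : nat).
Hypothesis comm_partial : partials_commute K m.
Variable N : nat.
Notation mults := {ffun 'I_N.+1 -> 'I_N.+2}.
Implicit Types (f : 'rV[K]_(1 + m) -> K) (J : jet K m) (n : mults) (k : 'I_N.+1).

(** For [n ord0 = 0], the number of ways to choose disjoint blocks in a set of [q] elements, [n k]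
    of them of size [k]. It vanishes when [mult_wt n > q]. *)
Definition faa_coef (q : nat) n : K := (q ^_ mult_wt n)%:R / (mult_denom n)%:R.

(** With [M = mult_wt n], the falling factorial splits along [M - 1 = (k - 1) + (M - k)], and
    ['C(q, k-1) (k-1)! = q ^_ (k-1)]. *)
Lemma faa_coef_sub q k n : (0 < k)%N -> (0 < n k)%N -> (mult_wt n <= q.+1)%N ->
  'C(q, k.-1)%:R * faa_coef (q.+1 - k) (mult_sub k n)
  = (q ^_ (mult_wt n).-1)%:R / (mult_denom n)%:R * (n k * k)%:R.
Proof.
move=> k0 nk wq; rewrite /faa_coef (mult_denom_sub nk) (mult_wt_sub nk).
rewrite [LHS]mulrA [RHS]mulrAC; apply/eqP; rewrite eqr_div -?natrM; last first.
- by rewrite pnatr_eq0 -lt0n !muln_gt0 fact_gt0 nk mult_denom_gt0.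
- by rewrite pnatr_eq0 -lt0n mult_denom_gt0.
apply/eqP; congr _%:R.
have -> : (k + mult_wt (mult_sub k n)).-1 = (k.-1 + mult_wt (mult_sub k n))%N by lia.
move: (mult_wt _) => w; case: (k : nat) k0 => // k' _ /=.
rewrite subSS.
by rewrite ffact_addr factS -(bin_ffact q k'); ring.
Qed.

Definition faa_term a n f J : K :=
  jet_polar (mult_parts n) (iter a (@partial_x K m) f) J.

Definition faa (q : nat) f J : K :=
  \sum_(n : mults | (n ord0 == 0 :> nat) && (mult_wt n <= q)%N)
    faa_coef q n * faa_term (q - mult_wt n) n f J.

(** [F] stays arbitrary because the regrouping serves twice: in the recursion [faaS], and for the
    terms in [X] of the prolongation coefficients. *)
Lemma sum_faa_shift q (F : 'I_N.+1 -> mults -> K) : (q <= N)%N ->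
  \sum_(k : 'I_N.+1 | (0 < k)%N) 'C(q, k.-1)%:R *
    \sum_(n : mults | (n ord0 == 0 :> nat) && (k + mult_wt n <= q.+1)%N)
       faa_coef (q.+1 - k) n * F k n
  = \sum_(n : mults | (n ord0 == 0 :> nat) && (mult_wt n <= q.+1)%N)
      (q ^_ (mult_wt n).-1)%:R / (mult_denom n)%:R *
      \sum_(k : 'I_N.+1 | (0 < k)%N && (0 < n k)%N) (n k * k)%:R * F k (mult_sub k n).
Proof.
move=> qN; under eq_bigr => k _ do rewrite big_distrr /=.
rewrite (@sum_mult_shift N N.+1 K (fun k n => 'C(q, k.-1)%:R * (faa_coef (q.+1 - k) n * F k n))) //.
apply: eq_bigr => n /andP[_ wn]; rewrite big_distrr /=.
by apply: eq_bigr => k /andP[k0 nk]; rewrite mulrA faa_coef_sub // mulrA.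
Qed.

Lemma sum_mult_wt n :
  \sum_(k : 'I_N.+1 | (0 < k)%N && (0 < n k)%N) (n k * k)%:R = (mult_wt n)%:R :> K.
Proof.
rewrite natr_sum big_mkcond /=; apply: eq_bigr => k _.
by case: ifP => //; case: (k : nat) (n k : nat) => [|a] [|b] //=; rewrite muln0.
Qed.

Lemma ffact_Pascal q w : (q.+1 ^_ w = q ^_ w + q ^_ w.-1 * w)%N.
Proof.
case: w => [|w] //=; rewrite ffactSS ffactnSr.
by have [wq|qw] := leqP w q; [nia | rewrite ffact_small //; lia].
Qed.

(** After regrouping by [n], the jet polynomial no longer depends on the part [k] removed, so the
    inner sum is [M = \sum_k k n_k] times one term. The coefficients then add up by
    [q ^_ M + q ^_ (M-1) M = q.+1 ^_ M]. *)
Lemma faaS q f J : (q < N)%N -> smooth f ->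
  faa q.+1 f J = faa q (partial_x f) J
    + \sum_(i < q.+1) 'C(q, i)%:R
        * \sum_(l < m) jet_y J i.+1 l * faa (q - i) (partial_y l f) J.
Proof.
move=> qN sf.
pose F k n := jet_polar ((k : nat) :: mult_parts n)
  (iter (q.+1 - (k + mult_wt n)) (@partial_x K m) f) J.
have -> : \sum_(i < q.+1) 'C(q, i)%:R
        * \sum_(l < m) jet_y J i.+1 l * faa (q - i) (partial_y l f) J =
    \sum_(k : 'I_N.+1 | (0 < k)%N) 'C(q, k.-1)%:R *
    \sum_(n : mults | (n ord0 == 0 :> nat) && (k + mult_wt n <= q.+1)%N)
       faa_coef (q.+1 - k) n * F k n.
  rewrite [RHS]big_mkcond [RHS]big_ord_recl ltnn /= add0r.
  (* The sum over [i] is widened so that [k = i + 1] runs over all nonzero parts; a part [k > q + 1]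
     admits no [n]. *)
  rewrite (big_ord_widen N (fun i => 'C(q, i)%:R
        * \sum_(l < m) jet_y J i.+1 l * faa (q - i) (partial_y l f) J)) //.
  rewrite big_mkcond /=; apply: eq_bigr => i _; rewrite -[bump 0 i]/i.+1.
  case: ltnP => iq; last first.
    rewrite big_pred0 ?mulr0 // => n.
    by apply/negP => /andP[_]; lia.
  congr (_ * _); rewrite /F /=.
  under [RHS]eq_bigr => n _ do rewrite big_distrr /=.
  rewrite exchange_big /=; apply: eq_bigr => l _.
  rewrite /faa big_distrr /=; apply: eq_big => n.
    by congr (_ && _); lia.
  move=> _; by rewrite subnDA !subSS mulrCA /faa_term iter_x_partial_y.
rewrite sum_faa_shift ?(ltnW qN) //.
rewrite /faa !big_mkcondr -big_split /=; apply: eq_bigr => n _.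
case: leqP => wn; last by rewrite leqNgt (ltn_trans _ wn) // addr0.
rewrite (eq_bigr (fun k => (n k * k)%:R * faa_term (q.+1 - mult_wt n) n f J)); last first.
  move=> k /andP[k0 nk]; rewrite /F /faa_term -(mult_wt_sub nk); congr (_ * _).
  apply/esym/jet_polar_perm => //; first exact: smooth_iter_x.
  exact: mult_parts_sub.
rewrite -big_distrl /= sum_mult_wt mulrA.
(* At weight [q + 1] the coefficient [q ^_ (q+1)] is [0], so the case distinction disappears. *)
have -> : (if (mult_wt n <= q)%N then
      faa_coef q n * faa_term (q - mult_wt n) n (partial_x f) J else 0)
    = faa_coef q n * faa_term (q.+1 - mult_wt n) n f J.
  case: leqP => wq; last by rewrite /faa_coef ffact_small // !mul0r.
  by rewrite /faa_term -iterSr subSn.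
rewrite -mulrDl; congr (_ * _).
by rewrite /faa_coef ffact_Pascal natrD natrM mulrDl [_ * _ / _]mulrAC.
Qed.

Lemma faa0 f J : faa 0 f J = f (jet_base J).
Proof.
rewrite /faa (big_pred1 [ffun=> ord0]); last by move=> n; rewrite leqn0 mult_wt_eq0.
by rewrite /faa_coef /faa_term mult_wt0 mult_denom0 mult_parts0 /= divr1 mul1r.
Qed.

End FaaDiBruno.

(** * Total derivatives *)

Section TotalDerivative.
Variables (K : numFieldType) (m : nat).
Implicit Types (f : 'rV[K]_(1 + m) -> K) (J : jet K m) (F G : jet K m -> K).

Lemma set_jet_x_id J : set_jet_x J (jet_x J) = J.
Proof. by case: J. Qed.

Lemma set_jet_y_id J k l : set_jet_y J k l (jet_y J k l) = J.
Proof.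
case: J => x y; rewrite /set_jet_y /=; congr Jet.
by apply/funext => k'; apply/funext => l'; case: andP => // -[/eqP-> /eqP->].
Qed.

(* [total_D] is built from [derive1], which is junk for a non derivable function,
   so derivability along the coordinates involved is part of the relation. *)
Record has_total_D (lam : nat) F F' : Prop := HasTotalD {
  htd_x : forall J, derivable (fun t => F (set_jet_x J t)) (jet_x J) 1;
  htd_y : forall J k l, (k < lam)%N ->
    derivable (fun t => F (set_jet_y J k l t)) (jet_y J k l) 1;
  htd_eq : forall J, total_D lam F J = F' J }.

Variable lam : nat.

Lemma has_total_D_ext F G F' G' : F =1 G -> F' =1 G' ->
  has_total_D lam F F' -> has_total_D lam G G'.
Proof. by move=> /funext <- /funext <-. Qed.

Lemma has_total_D_cst c : has_total_D lam (fun=> c) (fun=> 0).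
Proof.
split=> [J|J k l _|J]; [exact: derivable_cst..|].
rewrite /total_D /djet_x derive1E derive_cst add0r big1 // => i _.
by rewrite big1 // => l _; rewrite /djet_y derive1E derive_cst mulr0.
Qed.

Lemma has_total_D_add F G F' G' :
  has_total_D lam F F' -> has_total_D lam G G' ->
  has_total_D lam (fun J => F J + G J) (fun J => F' J + G' J).
Proof.
move=> [Fx Fy FE] [Gx Gy GE]; split=> [J|J k l kl|J].
- exact: derivableD.
- by apply: derivableD; [exact: Fy | exact: Gy].
rewrite -FE -GE /total_D addrACA -big_split /=; congr (_ + _).
  rewrite /djet_x !derive1E; exact: (deriveD (Fx J) (Gx J)).
apply: eq_bigr => i _; rewrite -big_split; apply: eq_bigr => l _ /=.
rewrite -mulrDr /djet_y !derive1E; congr (_ * _).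
exact: (deriveD (Fy J i l (ltn_ord i)) (Gy J i l (ltn_ord i))).
Qed.

Lemma has_total_D_mul F G F' G' :
  has_total_D lam F F' -> has_total_D lam G G' ->
  has_total_D lam (fun J => F J * G J) (fun J => F' J * G J + F J * G' J).
Proof.
move=> [Fx Fy FE] [Gx Gy GE]; split=> [J|J k l kl|J].
- exact: derivableM.
- by apply: derivableM; [exact: Fy | exact: Gy].
rewrite -FE -GE /total_D mulrDl mulrDr addrACA; congr (_ + _).
  rewrite /djet_x !derive1E; have -> := deriveM (Fx J) (Gx J).
  by rewrite set_jet_x_id addrC /GRing.scale /= [_ * G J]mulrC.
rewrite mulr_suml mulr_sumr -big_split /=.
apply: eq_bigr => i _; rewrite mulr_suml mulr_sumr -big_split; apply: eq_bigr => l _ /=.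
rewrite /djet_y !derive1E; have -> := deriveM (Fy J i l (ltn_ord i)) (Gy J i l (ltn_ord i)).
by rewrite set_jet_y_id /GRing.scale /=; ring.
Qed.

Lemma has_total_D_sum (I : Type) (r : seq I) (P : pred I) (F F' : I -> jet K m -> K) :
  (forall i, P i -> has_total_D lam (F i) (F' i)) ->
  has_total_D lam (fun J => \sum_(i <- r | P i) F i J)
                  (fun J => \sum_(i <- r | P i) F' i J).
Proof.
move=> H; elim: r => [|i r IH].
  apply: has_total_D_ext (has_total_D_cst 0) => J; by rewrite big_nil.
case Pi : (P i); last first.
  by apply: has_total_D_ext IH => J; rewrite big_cons Pi.
by apply: has_total_D_ext (has_total_D_add (H i Pi) IH) => J; rewrite big_cons Pi.
Qed.

Lemma has_total_D_scale c F F' :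
  has_total_D lam F F' -> has_total_D lam (fun J => c * F J) (fun J => c * F' J).
Proof.
move=> HF; apply: has_total_D_ext (has_total_D_mul (has_total_D_cst c) HF) => J //.
by rewrite mul0r add0r.
Qed.

Lemma has_total_D_sub F G F' G' :
  has_total_D lam F F' -> has_total_D lam G G' ->
  has_total_D lam (fun J => F J - G J) (fun J => F' J - G' J).
Proof.
move=> HF HG.
by apply: has_total_D_ext (has_total_D_add HF (has_total_D_scale (-1) HG)) => J;
  rewrite mulN1r.
Qed.

(** [total_D lam] differentiates only along the coordinates [y_k] with [k < lam]. *)
Lemma has_total_D_jet_y k l : (k < lam)%N ->
  has_total_D lam (fun J => jet_y J k l) (fun J => jet_y J k.+1 l).
Proof.
move=> kl.
have lineE J i l' : (fun t => jet_y (set_jet_y J i l' t) k l) =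
    if (k == i) && (l == l') then id else cst (jet_y J k l).
  by rewrite /set_jet_y /=; case: ifP.
split=> [J|J i l' _|J].
- exact: derivable_cst.
- by rewrite lineE; case: ifP => _; [exact: derivable_id | exact: derivable_cst].
rewrite /total_D /djet_x derive1E derive_cst add0r.
rewrite (bigD1 (Ordinal kl)) //= (bigD1 l) //= [X in _ + X + _]big1 => [|l' nl].
  rewrite addr0 [X in _ + X]big1 => [|i ni].
    by rewrite addr0 /djet_y lineE !eqxx /= derive1E derive_id mulr1.
  apply: big1 => l' _; rewrite /djet_y lineE.
  case: eqP => [e|_]; first by case/eqP: ni; apply: val_inj.
  by rewrite /= derive1E derive_cst mulr0.
rewrite /djet_y lineE eqxx eq_sym (negPf nl) /= derive1E derive_cst mulr0 //.
Qed.

Lemma jet_base_set_x J t :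
  jet_base (set_jet_x J t) = (t - jet_x J) *: delta_mx 0 (lshift m ord0) + jet_base J.
Proof.
apply/rowP => i; rewrite !mxE; case: splitP => [c eo|c eo]; rewrite !mxE.
  have -> : i = lshift m ord0 by apply: val_inj; rewrite /= eo ord1.
  by rewrite eqxx mulr1 subrK.
have -> : (i == lshift m ord0) = false by apply/eqP => /(congr1 val) /=; rewrite eo.
by rewrite mulr0 add0r.
Qed.

Lemma jet_base_set_y J l t :
  jet_base (set_jet_y J 0 l t) = (t - jet_y J 0 l) *: delta_mx 0 (rshift 1 l) + jet_base J.
Proof.
apply/rowP => i; rewrite !mxE; case: splitP => [c eo|c eo]; rewrite !mxE.
  have -> : (i == rshift 1 l) = false.
    by apply/eqP => /(congr1 val) /=; rewrite eo; case: c {eo} => -[].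
  by rewrite mulr0 add0r.
have -> : i = rshift 1 c by exact: val_inj.
rewrite /= (inj_eq (@rshift_inj _ _)); case: eqP => [->|_].
  by rewrite mulr1 subrK.
by rewrite mulr0 add0r.
Qed.

(** No chain rule is involved: moving [x] or [y_0^l] moves the base point along a basis vector, so
    the difference quotients are those of the partial derivatives. Coordinates of higher order leave
    the base point fixed. *)
Lemma has_total_D_base f : smooth f -> (0 < lam)%N ->
  has_total_D lam (fun J => f (jet_base J))
    (fun J => partial_x f (jet_base J)
       + \sum_(l < m) jet_y J 1 l * partial_y l f (jet_base J)).
Proof.
move=> sf lam0.
have quotE (u : 'rV[K]_(1 + m)) (g : K -> 'rV[K]_(1 + m)) b s : g s = b ->
     (forall t, g t = (t - s) *: u + b) ->
    (fun h : K => h^-1 *: (((fun t => f (g t)) \o shift s) (h *: 1) - f (g s)))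
    = (fun h : K => h^-1 *: ((f \o shift b) (h *: u) - f b)).
  by move=> gs gE; apply/funext => h /=; rewrite gE gs [h *: 1]mulr1 addrK.
have dx J : (fun h : K => h^-1 *: (((fun t => f (jet_base (set_jet_x J t))) \o
      shift (jet_x J)) (h *: 1) - f (jet_base (set_jet_x J (jet_x J)))))
    = (fun h : K => h^-1 *: ((f \o shift (jet_base J)) (h *: delta_mx 0 (lshift m ord0))
        - f (jet_base J))).
  apply: (quotE _ (fun t => jet_base (set_jet_x J t))); first by rewrite set_jet_x_id.
  exact: jet_base_set_x.
have dy J l : (fun h : K => h^-1 *: (((fun t => f (jet_base (set_jet_y J 0 l t))) \o
      shift (jet_y J 0 l)) (h *: 1) - f (jet_base (set_jet_y J 0 l (jet_y J 0 l)))))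
    = (fun h : K => h^-1 *: ((f \o shift (jet_base J)) (h *: delta_mx 0 (rshift 1 l))
        - f (jet_base J))).
  apply: (quotE _ (fun t => jet_base (set_jet_y J 0 l t))); first by rewrite set_jet_y_id.
  exact: jet_base_set_y.
have dyS J k l : (fun t => f (jet_base (set_jet_y J k.+1 l t))) = cst (f (jet_base J)).
  by [].
split=> [J|J k l _|J].
- by rewrite /derivable dx; exact: smooth_derivable.
- case: k => [|k]; last by rewrite dyS; exact: derivable_cst.
  by rewrite /derivable dy; exact: smooth_derivable.
rewrite /total_D /djet_x derive1E /derive dx; congr (_ + _).
case: lam lam0 => // lam' _; rewrite big_ord_recl /= [X in _ + X]big1 => [|i _].
  by rewrite addr0; apply: eq_bigr => l _; rewrite /djet_y derive1E /derive dy.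
by rewrite big1 // => l _; rewrite /djet_y /= dyS derive1E derive_cst mulr0.
Qed.

End TotalDerivative.

(** * Prolongation coefficients *)

(** The combinatorial part of Leibniz' rule: below, [u i.+1] comes from differentiating a jet
    coordinate and [u i] from differentiating its cofactor. *)
Lemma sum_bin_Pascal (R : comNzRingType) (u : nat -> R) q :
  \sum_(i < q.+1) 'C(q, i)%:R * (u i.+1 + u i)
  = \sum_(i < q.+2) 'C(q.+1, i)%:R * u i.
Proof.
under eq_bigr => i _ do rewrite mulrDr.
rewrite big_split /= [RHS]big_ord_recl /=.
under [in RHS]eq_bigr => i _ do rewrite -[bump 0 i]/i.+1 binS natrD mulrDl.
rewrite big_split /= addrA [RHS]addrC; congr (_ + _).
rewrite [LHS]big_ord_recl [in RHS]big_ord_recr /= [X in X%:R * u q.+1]bin_small // mul0r.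
by rewrite addr0 !bin0.
Qed.

Section Prolongation.
Variables (K : numFieldType) (m : nat).
Hypothesis comm_partial : partials_commute K m.
Variable N : nat.
Implicit Types (f : 'rV[K]_(1 + m) -> K) (J : jet K m).

(** [faaS] expresses the sum by lower orders [q - i] for partial derivatives of [f], whence a strong
    induction for all [f] at once. Leibniz and Pascal recombine the derivatives into [faaS] one
    order higher. *)
Lemma has_total_D_faa q f lam : (q < N)%N -> (q < lam)%N -> smooth f ->
  has_total_D lam (@faa K m N q f) (@faa K m N q.+1 f).
Proof.
elim/ltn_ind: q f => -[|q] IH f qN ql sf.
  apply: has_total_D_ext (has_total_D_base sf ql) => J; first by rewrite faa0.
  rewrite faaS // faa0 big_ord_recl big_ord0 addr0 bin0 mul1r.
  by under [in RHS]eq_bigr => l _ do rewrite faa0.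
have sfx : smooth (partial_x f) by exact: smooth_partial.
have sfy l : smooth (partial_y l f) by exact: smooth_partial.
pose u J i := \sum_(l < m) jet_y J i.+1 l * @faa K m N (q.+1 - i) (partial_y l f) J.
apply: (@has_total_D_ext _ _ _
  (fun J => @faa K m N q (partial_x f) J
    + \sum_(i < q.+1) 'C(q, i)%:R
        * \sum_(l < m) jet_y J i.+1 l * @faa K m N (q - i) (partial_y l f) J) _
  (fun J => @faa K m N q.+1 (partial_x f) J
    + \sum_(i < q.+1) 'C(q, i)%:R
        * \sum_(l < m) (jet_y J i.+2 l * @faa K m N (q - i) (partial_y l f) J
            + jet_y J i.+1 l * @faa K m N (q - i).+1 (partial_y l f) J))).
- by move=> J; rewrite [RHS]faaS // ltnW.
- move=> J; rewrite [RHS]faaS // -/(u J _) -(sum_bin_Pascal (u J)); congr (_ + _).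
  apply: eq_bigr => i _; congr (_ * _); rewrite /u subSS big_split /=.
  by rewrite subSn // -ltnS.
apply: has_total_D_add; first by apply: IH => //; exact: ltnW.
apply: has_total_D_sum => i _; apply: has_total_D_scale.
apply: has_total_D_sum => l _; apply: has_total_D_mul.
  by apply: has_total_D_jet_y; have := ltn_ord i; lia.
by apply: IH => //; lia.
Qed.

Variables (X : 'rV[K]_(1 + m) -> K) (Y : 'I_m -> 'rV[K]_(1 + m) -> K).
Hypotheses (sX : smooth X) (sY : forall j, smooth (Y j)).

Lemma prolongation_coef_faa q j J : (q <= N)%N ->
  prolongation_coef X Y j q J = @faa K m N q (Y j) J
    - \sum_(i < q) 'C(q, i)%:R * (jet_y J i.+1 j * @faa K m N (q - i) X J).
Proof.
elim: q J => [|q IH] J qN /=; first by rewrite big_ord0 subr0 faa0.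
pose v i := jet_y J i.+1 j * @faa K m N (q.+1 - i) X J.
have -> : prolongation_coef X Y j q = fun J => @faa K m N q (Y j) J
    - \sum_(i < q) 'C(q, i)%:R * (jet_y J i.+1 j * @faa K m N (q - i) X J).
  by apply/funext => J'; rewrite IH // ltnW.
have N0 : (0 < N)%N by exact: leq_ltn_trans qN.
have -> : total_D 1 (fun J' => X (jet_base J')) J = @faa K m N 1 X J.
  have -> : (fun J' => X (jet_base J')) = @faa K m N 0 X.
    by apply/funext => J'; rewrite faa0.
  exact: (htd_eq (@has_total_D_faa 0 X 1 N0 isT sX) J).
have HD : has_total_D q.+1 (fun J => @faa K m N q (Y j) J
    - \sum_(i < q) 'C(q, i)%:R * (jet_y J i.+1 j * @faa K m N (q - i) X J))
  (fun J => @faa K m N q.+1 (Y j) J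
    - \sum_(i < q) 'C(q, i)%:R * (jet_y J i.+2 j * @faa K m N (q - i) X J
        + jet_y J i.+1 j * @faa K m N (q - i).+1 X J)).
  apply: has_total_D_sub; first exact: has_total_D_faa.
  apply: has_total_D_sum => i _; apply: has_total_D_scale.
  apply: has_total_D_mul.
    by apply: has_total_D_jet_y; have := ltn_ord i; lia.
  by apply: has_total_D_faa => //; have := ltn_ord i; lia.
rewrite (htd_eq HD) -addrA -opprD; congr (_ - _).
(* The term [v q.+1] cancels between the two sides; the leftover [v q] is the correction
   [D X * y_(q+1)] of the recursion. *)
have := sum_bin_Pascal v q; rewrite [LHS]big_ord_recr [RHS]big_ord_recr /= !binn !mul1r.
rewrite [v q.+1 + _]addrC addrA => /addIr <-; congr (_ + _).
  apply: eq_bigr => i _; congr (_ * _); rewrite /v subSS.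
  by rewrite subSn // ltnW.
by rewrite /v subSnn mulrC.
Qed.

(** The contribution of one [n] once all indices [l] are summed: the Kronecker symbol has extracted
    [y_k^j], and the parts [k] in use play the role of [e]. *)
Definition prolongation_term j J (n : {ffun 'I_N.+1 -> 'I_N.+2}) : K :=
  (N ^_ (mult_wt n).-1)%:R / (mult_denom n)%:R *
  ((N.+1 - mult_wt n)%N%:R
     * jet_polar (mult_parts n) (iter (N - mult_wt n) (@partial_x K m) (Y j)) J
   - \sum_(k : 'I_N.+1 | (0 < k)%N && (0 < n k)%N) (n k * k)%:R *
       (jet_y J k j * jet_polar (mult_parts (mult_sub k n))
          (iter (N.+1 - mult_wt n) (@partial_x K m) X) J)).

Lemma prolongation_coef_mults j J :
  prolongation_coef X Y j N J = iter N (@partial_x K m) (Y j) (jet_base J)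
   + \sum_(n : {ffun 'I_N.+1 -> 'I_N.+2} |
        [&& n ord0 == 0 :> nat, mult_wt n <= N.+1 & 0 < mult_wt n]%N)
       prolongation_term j J n.
Proof.
rewrite prolongation_coef_faa //.
pose F k n := jet_y J (k : 'I_N.+1) j * @faa_term K m N (N.+1 - (k + mult_wt n)) n X J.
have -> : \sum_(i < N) 'C(N, i)%:R * (jet_y J i.+1 j * @faa K m N (N - i) X J)
  = \sum_(k : 'I_N.+1 | (0 < k)%N) 'C(N, k.-1)%:R *
    \sum_(n : {ffun 'I_N.+1 -> 'I_N.+2} |
        (n ord0 == 0 :> nat) && (k + mult_wt n <= N.+1)%N)
       faa_coef K (N.+1 - k) n * F k n.
  rewrite [RHS]big_mkcond [RHS]big_ord_recl ltnn /= add0r.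
  apply: eq_bigr => i _; rewrite -[bump 0 i]/i.+1 /= /faa; congr (_ * _).
  rewrite big_distrr /=; apply: eq_big => n.
    by congr (_ && _); have := ltn_ord i; lia.
  by move=> _; rewrite /F subSS mulrCA /= subnDA subSS.
rewrite sum_faa_shift //.
(* The terms in [X] reach weight [N + 1]; the sum for [Y j] is extended to it, with coefficient
   [N ^_ (N+1) = 0]. *)
have -> : @faa K m N N (Y j) J =
    \sum_(n : {ffun 'I_N.+1 -> 'I_N.+2} | (n ord0 == 0 :> nat) && (mult_wt n <= N.+1)%N)
      faa_coef K N n * faa_term (N - mult_wt n) n (Y j) J.
  rewrite /faa !big_mkcondr; apply: eq_bigr => n _.
  case: (ltngtP (mult_wt n) N.+1) => [wn|wn|wn]; first by rewrite -ltnS wn.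
    by rewrite leqNgt (ltn_trans _ wn).
  by rewrite wn ltnn /faa_coef ffact_small ?wn // !mul0r.
(* The zero function gives the isolated pure [x]-derivative of [Y j]. *)
rewrite -sumrB (bigD1 [ffun=> ord0]) /=; last by rewrite ffunE mult_wt0.
rewrite big_pred0 => [|k]; last by rewrite ffunE andbF.
rewrite mulr0 subr0 /faa_coef /faa_term mult_wt0 mult_denom0 mult_parts0 subn0.
rewrite /= divr1 mul1r; congr (_ + _); apply: eq_big => n.
  rewrite lt0n -andbA; case n0: (n ord0 == 0 :> nat) => //=.
  by rewrite -mult_wt_eq0 n0.
rewrite -mult_wt_eq0 => /andP[/andP[n0 wn]]; rewrite n0 /= => wn0.
(* For [M > 0], [N ^_ M = N ^_ (M-1) (N + 1 - M)] provides the common factor. *)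
rewrite /prolongation_term mulrBr; congr (_ - _).
  rewrite [RHS]mulrA [X in _ = X * _]mulrAC -natrM; congr (_%:R / _ * _).
  by case: (mult_wt n) wn0 => // w _; rewrite ffactnSr subSS.
congr (_ * _); apply: eq_bigr => k /andP[k0 nk].
by rewrite /F /faa_term -(mult_wt_sub nk).
Qed.

End Prolongation.

(** * From multiplicity functions to indexed sums *)

Section SumOverIndices.
Variables (K : numFieldType) (m : nat).
Hypothesis comm_partial : partials_commute K m.
Implicit Types (f : 'rV[K]_(1 + m) -> K) (J : jet K m).

Lemma foldr_partial_y_comm l (ls : seq 'I_m) f : smooth f ->
  foldr (@partial_y K m) (partial_y l f) ls = partial_y l (foldr (@partial_y K m) f ls).
Proof.
move=> sf; elim: ls => //= i ls ->; apply: comm_partial.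
by elim: ls => //= i' ls; exact: smooth_partial.
Qed.

(** [mixed_partial] differentiates in [x] last, whereas [jet_polar] receives a function already
    differentiated in [x]. *)
Lemma mixed_partial_iter a (ls : seq 'I_m) f : smooth f ->
  mixed_partial a ls f = foldr (@partial_y K m) (iter a (@partial_x K m) f) ls.
Proof.
move=> sf; elim: ls => //= i ls <-; rewrite /mixed_partial /=.
rewrite iter_x_partial_y //.
by elim: ls => //= i' ls; exact: smooth_partial.
Qed.

Lemma sum_tuple_cons (A : nmodType) (I : finType) q (G : seq I -> A) :
  \sum_(t : q.+1.-tuple I) G t = \sum_i \sum_(t : q.-tuple I) G (i :: t).
Proof.
rewrite pair_big /= (reindex (fun p : I * q.-tuple I => [tuple of p.1 :: p.2])) //=.
exists (fun t : q.+1.-tuple I => (thead t, [tuple of behead t])).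
  by move=> [i t] _ /=; congr (_, _); apply: val_inj.
by move=> t _; rewrite -tuple_eta.
Qed.

Lemma jet_polar_tuple q (ks : seq nat) f J : smooth f -> size ks = q ->
  jet_polar ks f J = \sum_(t : q.-tuple 'I_m)
    foldr (@partial_y K m) f t (jet_base J) * \prod_(p <- zip ks t) jet_y J p.1 p.2.
Proof.
elim: ks q f => [|k ks IH] [|q] f sf //= sz.
  rewrite (big_pred1 [tuple]) => [|t]; first by rewrite big_nil mulr1.
  by apply/esym/eqP; exact: tuple0.
rewrite (sum_tuple_cons _ (fun t => foldr (@partial_y K m) f t (jet_base J) *
   \prod_(p <- zip (k :: ks) t) jet_y J p.1 p.2)).
apply: eq_bigr => l _; case: sz => sz; rewrite (IH q) //; last exact: smooth_partial.
rewrite big_distrr; apply: eq_bigr => t _ /=.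
by rewrite big_cons /= foldr_partial_y_comm // mulrCA.
Qed.

Lemma sum_ffun_tuple (A : nmodType) (I T : finType) (r : seq T) (G : seq I -> A) :
    uniq r -> (forall x, x \in r) ->
  \sum_(l : {ffun T -> I}) G [seq l s | s <- r] = \sum_(t : (size r).-tuple I) G t.
Proof.
(* An empty [T] is treated apart, since the bijection below uses a default label [s0]. *)
move=> ur rT; case: (pickP (fun _ : T => true)) => [s0 _|T0]; last first.
  have -> : r = [::] by case: (r) => // s0; have := T0 s0.
  rewrite (big_pred1 [tuple]) => [|t]; last by apply/esym/eqP; exact: tuple0.
  rewrite (big_pred1 [ffun x => False_rect I (notF (esym (T0 x)))]) // => l /=.
  by apply/esym/eqP/ffunP => x; have := T0 x.
have idx_lt s : (index s r < size r)%N by rewrite index_mem.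
have idx (l : {ffun T -> I}) : size [seq l s | s <- r] == size r by rewrite size_map.
pose F (t : (size r).-tuple I) := [ffun s => tnth t (Ordinal (idx_lt s))].
have FK t : [seq F t s | s <- r] = t.
  pose x0 := tnth t (Ordinal (idx_lt s0)).
  apply: (@eq_from_nth _ x0) => [|i]; first by rewrite size_map size_tuple.
  rewrite size_map => ir; rewrite (nth_map s0) // ffunE (tnth_nth x0) /=.
  by rewrite index_uniq.
rewrite (reindex F) /=; last first.
  exists (fun l => Tuple (idx l)) => [t _|l _]; first by apply: val_inj; rewrite /= FK.
  apply/ffunP => s; rewrite ffunE (tnth_nth (l s0)) /= (nth_map s0) ?index_mem //.
  by rewrite nth_index.
by apply: eq_bigr => t _; rewrite FK.
Qed.

Lemma prod_zip_map (I T : Type) (r : seq T) (w : T -> nat) (l : T -> I) (y : nat -> I -> K) :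
  \prod_(p <- zip [seq w s | s <- r] [seq l s | s <- r]) y p.1 p.2
  = \prod_(s <- r) y (w s) (l s).
Proof. by elim: r => [|s r IH] /=; rewrite ?big_nil // !big_cons IH. Qed.

Variables (T : finType) (w : T -> nat).

Lemma sum_mixed_partial a f J : smooth f ->
  \sum_(l : {ffun T -> 'I_m}) mixed_partial a [seq l s | s : T] f (jet_base J)
      * \prod_(s : T) jet_y J (w s) (l s)
  = jet_polar [seq w s | s : T] (iter a (@partial_x K m) f) J.
Proof.
move=> sf; pose r : seq T := fintype.enum (mem T).
have szr : size [seq w s | s : T] = size r by rewrite size_map.
rewrite (jet_polar_tuple _ (smooth_iter_x a sf) szr).
pose G (t : seq 'I_m) := foldr (@partial_y K m) (iter a (@partial_x K m) f) t (jet_base J)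
  * \prod_(p <- zip [seq w s | s : T] t) jet_y J p.1 p.2.
transitivity (\sum_(l : {ffun T -> 'I_m}) G [seq l s | s <- r]); last first.
  by apply: (sum_ffun_tuple G) => [|x]; rewrite ?enum_uniq ?mem_enum.
by apply: eq_bigr => l _; rewrite /G prod_zip_map big_enum mixed_partial_iter.
Qed.

(** The Kronecker symbol fixes the index at [s0] to [j], which releases the factor [y_(w s0)^j]; the
    other indices stay free. *)
Lemma sum_mixed_partial_omit a f J (s0 : T) j : smooth f ->
  \sum_(l : {ffun T -> 'I_m}) (l s0 == j)%:R
      * mixed_partial a [seq l s | s : T in predC1 s0] f (jet_base J)
      * \prod_(s : T) jet_y J (w s) (l s)
  = jet_y J (w s0) j
      * jet_polar [seq w s | s : T in predC1 s0] (iter a (@partial_x K m) f) J.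
Proof.
move=> sf; set r := enum (predC1 s0).
have szr : size [seq w s | s : T in predC1 s0] = size r by rewrite size_map.
rewrite (jet_polar_tuple _ (smooth_iter_x a sf) szr).
(* The omitted label is listed first, so the head of the tuple is its index; the value on the empty
   list is never reached. *)
pose G (t : seq 'I_m) := if t is i :: t' then (i == j)%:R *
    foldr (@partial_y K m) (iter a (@partial_x K m) f) t' (jet_base J)
    * (jet_y J (w s0) i * \prod_(p <- zip [seq w s | s <- r] t') jet_y J p.1 p.2) else 0.
have ur : uniq (s0 :: r) by rewrite /= mem_enum /= !inE eqxx enum_uniq.
have rT x : x \in s0 :: r by rewrite inE mem_enum /= !inE orbN.
have := sum_ffun_tuple (r := s0 :: r) G ur rT.
rewrite [X in _ = X -> _](sum_tuple_cons _ G) (bigD1 j) //= [X in _ + X]big1 => [|i ij]; last first.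
  by rewrite big1 // => t _; rewrite (negPf ij) !mul0r.
rewrite addr0 big_distrr /= => eG; transitivity (\sum_(l : {ffun T -> 'I_m}) G [seq l s | s <- s0 :: r]).
  apply: eq_bigr => l _ /=; rewrite mixed_partial_iter // prod_zip_map; congr (_ * _).
  by rewrite (bigD1 s0) //= /r [in RHS]big_enum.
rewrite eG; apply: eq_bigr => t _.
by rewrite eqxx mul1r mulrCA.
Qed.

End SumOverIndices.

(** * The encoding of multiplicity functions by pairs [(lambda, mu)] *)

Section MultiplicityForm.
Variables (N d : nat).
Notation mults := {ffun 'I_N.+1 -> 'I_N.+2}.
Notation lambdas := {ffun 'I_d -> 'I_N.+1}.
Notation mus := {ffun 'I_d -> 'I_N.+2}.
Implicit Types (lambda : lambdas) (mu : mus) (k : 'I_N.+1) (n : mults).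

Definition mults_of (p : lambdas * mus) : mults :=
  [ffun k => if [pick e | p.1 e == k] is Some e then p.2 e else ord0].

Definition mult_supp n : {set 'I_N.+1} := [set k | (0 < n k)%N].

Lemma lambda_ok_gt0 lambda e : lambda_ok lambda -> (0 < lambda e)%N.
Proof. by case/andP => /forallP. Qed.

Lemma lambda_ok_mono lambda (e1 e2 : 'I_d) : lambda_ok lambda ->
  (e1 < e2)%N -> (lambda e1 < lambda e2)%N.
Proof. by case/andP => _ /forallP /(_ e1) /forallP /(_ e2) /implyP. Qed.

Lemma lambda_ok_inj lambda : lambda_ok lambda -> injective lambda.
Proof.
move=> ok e1 e2 e12; apply: val_inj => /=.
by case: (ltngtP e1 e2) => // /(lambda_ok_mono ok); rewrite e12 ltnn.
Qed.

Lemma mults_of_at lambda mu e : lambda_ok lambda -> mults_of (lambda, mu) (lambda e) = mu e.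
Proof.
move=> ok; rewrite ffunE; case: pickP => [e' /= /eqP /(lambda_ok_inj ok) -> //|].
by move=> /(_ e) /=; rewrite eqxx.
Qed.

Lemma mults_of_out lambda mu k : (forall e, lambda e != k) -> mults_of (lambda, mu) k = ord0.
Proof.
by move=> out; rewrite ffunE; case: pickP => [e /= le|//]; have := out e; rewrite le.
Qed.

(** The operation is general in order to cover the weight and the counts as well as the
    denominator. *)
Lemma big_mults_of (A : Type) (idx : A) (op : Monoid.com_law idx) lambda (F : 'I_N.+1 -> A) :
    lambda_ok lambda -> (forall k, (forall e, lambda e != k) -> F k = idx) ->
  \big[op/idx]_k F k = \big[op/idx]_e F (lambda e).
Proof.
move=> ok out; rewrite -(@big_imset _ _ _ _ _ lambda predT F); last first.
  by move=> e1 e2 _ _; exact: lambda_ok_inj.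
rewrite [RHS]big_mkcond; apply: eq_bigr => k _; case: ifPn => // kout.
by apply: out => e; apply: contraNneq kout => <-; exact: imset_f.
Qed.

Lemma mult_wt_mults_of lambda mu : lambda_ok lambda ->
  mult_wt (mults_of (lambda, mu)) = weight lambda mu.
Proof.
move=> ok; rewrite /mult_wt (big_mults_of _ ok) => [|k /(mults_of_out mu) -> //].
by apply: eq_bigr => e _; rewrite mults_of_at.
Qed.

Lemma mult_denom_mults_of lambda mu : lambda_ok lambda ->
  mult_denom (mults_of (lambda, mu)) = (\prod_(e < d) ((lambda e)`! ^ mu e * (mu e)`!))%N.
Proof.
move=> ok; rewrite /mult_denom (big_mults_of _ ok) => [|k /(mults_of_out mu) -> //].
by apply: eq_bigr => e _; rewrite mults_of_at.
Qed.

Lemma mult_parts_mults_of lambda mu : lambda_ok lambda ->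
  perm_eq (mult_parts (mults_of (lambda, mu)))
    [seq (lambda (tag s) : nat) | s : {e : 'I_d & 'I_(mu e)}].
Proof.
move=> ok; apply/permP => p; rewrite count_mult_parts.
rewrite (big_mults_of _ ok) => [|k /(mults_of_out mu) -> //].
rewrite /image_mem count_map -sum1_count big_enum_cond [RHS]big_mkcond /=.
transitivity (\sum_(e < d) \sum_(nu < mu e) (p (lambda e) : nat))%N; last first.
  by rewrite sig_big_dep /=; apply: eq_big => // s _; rewrite inE; case: (p _).
by apply: eq_bigr => e _; rewrite mults_of_at // sum_nat_const card_ord.
Qed.

Definition index_ok (p : lambdas * mus) : bool := lambda_ok p.1 && mu_ok p.1 p.2.

Lemma mult_supp_mults_of p : index_ok p -> mult_supp (mults_of p) = p.1 @: 'I_d.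
Proof.
case: p => lambda mu /andP[/= ok /andP[/forallP mu0 _]].
apply/setP => k; rewrite inE; apply/idP/imsetP => [|[e _ ->]].
  rewrite ffunE; case: pickP => [e /= /eqP ke _|_]; last by rewrite ltnn.
  by exists e; rewrite ?inE.
by rewrite mults_of_at.
Qed.

(** A strictly increasing [lambda] is determined by its image, the support; [mu] is then read off
    the values. *)
Lemma mults_of_inj : {in index_ok &, injective mults_of}.
Proof.
move=> [lambda mu] [lambda' mu'] okp okp' e12.
have /andP[/= ok _] := okp; have /andP[/= ok' _] := okp'.
have sorted_ok (lam : lambdas) : lambda_ok lam ->
    sorted ltn [seq (lam e : nat) | e <- fintype.enum 'I_d].
  move=> oklam; have := iota_ltn_sorted 0 d; rewrite -val_enum_ord !sorted_map.
  by apply: sub_sorted => e1 e2; exact: lambda_ok_mono.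
have eq_lam : lambda = lambda'.
  have : [seq (lambda e : nat) | e <- fintype.enum 'I_d]
      = [seq (lambda' e : nat) | e <- fintype.enum 'I_d].
    apply: (irr_sorted_eq ltn_trans ltnn); [exact: sorted_ok..|].
    have := mult_supp_mults_of okp; rewrite e12 (mult_supp_mults_of okp') /= => /setP im x.
    apply/mapP/mapP => -[e _ ->].
      have : lambda e \in lambda @: 'I_d by apply: imset_f; rewrite inE.
      by rewrite -im => /imsetP[e' _ ->]; exists e'; rewrite ?mem_enum.
    have : lambda' e \in lambda' @: 'I_d by apply: imset_f; rewrite inE.
    by rewrite im => /imsetP[e' _ ->]; exists e'; rewrite ?mem_enum.
  by move/eq_in_map => eql; apply/ffunP => e; apply: val_inj; apply: eql; rewrite mem_enum.
rewrite -eq_lam in e12 *; congr (_, _); apply/ffunP => e.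
by rewrite -(mults_of_at mu e ok) e12 mults_of_at.
Qed.

Lemma mults_of_imset : (0 < d)%N ->
  mults_of @: [set p | index_ok p] =
  [set n : mults | [&& n ord0 == 0 :> nat, mult_wt n <= N.+1, 0 < mult_wt n & #|mult_supp n| == d]%N].
Proof.
move=> d_gt0; apply/setP => n; rewrite inE; apply/imsetP/idP.
  move=> [[lambda mu]]; rewrite inE => okp ->.
  have /andP[/= ok /andP[/forallP mu0 wt_le]] := okp.
  rewrite mult_supp_mults_of // card_imset; last exact: lambda_ok_inj.
  rewrite card_ord eqxx andbT !mult_wt_mults_of // wt_le /=.
  rewrite mults_of_out /= => [|e]; last by rewrite -val_eqE /= -lt0n lambda_ok_gt0.
  rewrite /weight (bigD1 (Ordinal d_gt0)) //= addn_gt0 muln_gt0 mu0 lambda_ok_gt0 //.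
move=> /and4P[n0 wt_le _ /eqP ed].
(* Ordinals are enumerated in increasing order, so [ev] lists the support increasingly. *)
pose ev (e : 'I_d) : 'I_N.+1 := enum_val (cast_ord (esym ed) e).
have evS e : (0 < n (ev e))%N by have := enum_valP (cast_ord (esym ed) e); rewrite inE.
have ev_mono (e1 e2 : 'I_d) : (e1 < e2)%N -> (ev e1 < ev e2)%N.
  move=> e12; rewrite /ev !(enum_val_nth ord0) /=.
  rewrite -!(nth_map _ 0%N val) -?cardE ?ed //.
  apply: (sorted_ltn_nth ltn_trans); rewrite ?inE ?size_map -?cardE ?ed //.
  rewrite sorted_map; apply: sorted_filter => [x y z|]; first exact: ltn_trans.
  by rewrite -(@sorted_map _ _ val ltn) -enumT val_enum_ord iota_ltn_sorted.
have ok : lambda_ok [ffun e => ev e].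
  apply/andP; split; first apply/forallP => e.
    rewrite ffunE lt0n; apply: contraTneq (evS e) => e0.
    have -> : ev e = ord0 by apply: val_inj.
    by rewrite (eqP n0).
  by apply/forallP => e1; apply/forallP => e2; apply/implyP; rewrite !ffunE; exact: ev_mono.
have en : mults_of ([ffun e => ev e], [ffun e => n (ev e)]) = n.
  apply/ffunP => k; case: (posnP (n k)) => nk.
    rewrite mults_of_out; first by apply: val_inj; rewrite /= nk.
    by move=> e; rewrite ffunE; apply: contraTneq (evS e) => ->; rewrite nk.
  have kS : k \in mult_supp n by rewrite inE.
  have <- : ev (cast_ord ed (enum_rank_in kS k)) = k.
    by rewrite /ev cast_ordK enum_rankK_in.
  set e := cast_ord _ _; have := mults_of_at [ffun e => n (ev e)] e ok.
  by rewrite !ffunE.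
exists ([ffun e => ev e], [ffun e => n (ev e)]) => //.
rewrite inE /index_ok ok /= /mu_ok -mult_wt_mults_of // en wt_le andbT.
by apply/forallP => e; rewrite ffunE.
Qed.

End MultiplicityForm.

(** The functions [n] are sorted by the size [d] of their support. *)
Lemma sum_mults_of (A : nmodType) (N : nat) (h : {ffun 'I_N.+1 -> 'I_N.+2} -> A) :
  \sum_(1 <= d < N.+2)
    \sum_(lambda : {ffun 'I_d -> 'I_N.+1} | lambda_ok lambda)
    \sum_(mu : {ffun 'I_d -> 'I_N.+2} | mu_ok lambda mu) h (mults_of (lambda, mu))
  = \sum_(n : {ffun 'I_N.+1 -> 'I_N.+2} |
        [&& n ord0 == 0 :> nat, mult_wt n <= N.+1 & 0 < mult_wt n]%N) h n.
Proof.
transitivity (\sum_(1 <= d < N.+2) \sum_(n : {ffun 'I_N.+1 -> 'I_N.+2} |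
    [&& n ord0 == 0 :> nat, mult_wt n <= N.+1 & 0 < mult_wt n]%N
    && (d == #|mult_supp n|)) h n).
  apply: eq_big_nat => d /andP[d0 _]; rewrite pair_big_dep /=.
  transitivity (\sum_(n in @mults_of N d @: [set p | @index_ok N d p]) h n).
    rewrite big_imset /= => [|p q].
      by apply: eq_big => [[lambda mu]|[lambda mu] _] //; rewrite inE.
    by rewrite !inE; exact: mults_of_inj.
  rewrite mults_of_imset //; apply: eq_bigl => n.
  by rewrite inE [d == _]eq_sym -!andbA.
under eq_bigr => d _ do rewrite big_mkcondr /=.
rewrite exchange_big /=; apply: eq_bigr => n /and3P[n0 _ wt0].
(* The size is in range: the support lies in a set of [N + 1] elements and is nonempty because the
   weight is positive. *)
rewrite -big_mkcond big_nat1_eq; case: ifPn => //; rewrite ltnS.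
have -> : (#|mult_supp n| <= N.+1)%N by rewrite -[X in (_ <= X)%N]card_ord max_card.
rewrite andbT card_gt0 negbK => /eqP S0; move: wt0.
rewrite lt0n => /eqP; case; apply: big1 => k _.
have : k \notin mult_supp n by rewrite S0 inE.
by rewrite inE -leqNgt leqn0 => /eqP ->.
Qed.

(** * Summation over the indices [l] for fixed [lambda] and [mu] *)

Section Assembly.
Variables (K : numFieldType) (m : nat).
Hypothesis comm_partial : partials_commute K m.
Variables (X : 'rV[K]_(1 + m) -> K) (Y : 'I_m -> 'rV[K]_(1 + m) -> K).
Hypotheses (sX : smooth X) (sY : forall j, smooth (Y j)).
Variables (N d : nat) (lambda : {ffun 'I_d -> 'I_N.+1}) (mu : {ffun 'I_d -> 'I_N.+2}).
Hypotheses (okl : lambda_ok lambda) (okm : mu_ok lambda mu).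

Lemma prod_label (l : {ffun {e : 'I_d & 'I_(mu e)} -> 'I_m}) (J : jet K m) :
  \prod_(e < d) \prod_(nu < mu e) jet_y J (lambda e) (l (label nu))
  = \prod_(s : {e : 'I_d & 'I_(mu e)}) jet_y J (lambda (tag s)) (l s).
Proof.
rewrite (sig_big_dep _ (fun=> predT) (fun e (nu : 'I_(mu e)) => jet_y J (lambda e) (l (label nu)))).
by apply: eq_bigr => -[e nu].
Qed.

Lemma perm_mult_parts_omit e (nu : 'I_(mu e)) :
  perm_eq (mult_parts (mult_sub (lambda e) (mults_of (lambda, mu))))
    [seq (lambda (tag s) : nat) | s : {e : 'I_d & 'I_(mu e)} in predC1 (label nu)].
Proof.
have mue : (0 < mults_of (lambda, mu) (lambda e))%N.
  by rewrite mults_of_at //; exact: leq_ltn_trans (ltn_ord nu).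
rewrite -(perm_cons (lambda e : nat)) -(permPl (mult_parts_sub mue)).
rewrite (permPl (mult_parts_mults_of mu okl)).
apply/permP => p; rewrite -[RHS]/((p (lambda e) : nat) + count p _)%N.
rewrite /image_mem !count_map -!sum1_count !big_enum_cond.
by rewrite [LHS]big_mkcond [LHS](bigD1 (label nu)) //= big_mkcondr.
Qed.

Lemma sum_labels j (J : jet K m) :
  (\sum_(l : {ffun {e : 'I_d & 'I_(mu e)} -> 'I_m})
        let M := weight lambda mu in
        (N ^_ M.-1)%:R
          / (\prod_(e < d) ((lambda e)`! ^ mu e * (mu e)`!))%N%:R
        * ((N.+1 - M)%N%:R
             * mixed_partial (N - M) [seq l s | s : {e : 'I_d & 'I_(mu e)}]
                 (Y j) (jet_base J)
           - \sum_(e < d) \sum_(nu < mu e | nu == 0%N :> nat)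
               (l (label nu) == j)%:R * (mu e * lambda e)%N%:R
               * mixed_partial (N.+1 - M)
                   [seq l s | s : {e : 'I_d & 'I_(mu e)} in predC1 (label nu)]
                   X (jet_base J))
        * \prod_(e < d) \prod_(nu < mu e) jet_y J (lambda e) (l (label nu)))
  = prolongation_term X Y j J (mults_of (lambda, mu)).
Proof.
have mu0 e : (0 < mu e)%N by case/andP: okm => /forallP.
rewrite /prolongation_term mult_wt_mults_of // mult_denom_mults_of //=.
set M := weight lambda mu.
under eq_bigr => l _ do rewrite prod_label -mulrA mulrBl.
rewrite -big_distrr sumrB /=; congr (_ * (_ - _)).
  under eq_bigr => l _ do rewrite -mulrA.
  rewrite -big_distrr /=; congr (_ * _).
  rewrite (sum_mixed_partial comm_partial (fun s => lambda (tag s) : nat)) //.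
  apply: jet_polar_perm => //; first exact: smooth_iter_x.
  by rewrite perm_sym; exact: mult_parts_mults_of.
rewrite [RHS]big_mkcond (big_mults_of _ okl) /= => [|k kout]; last first.
  by rewrite mults_of_out // andbF.
under eq_bigr => l _ do rewrite mulr_suml.
rewrite exchange_big /=; apply: eq_bigr => e _.
rewrite mults_of_at // lambda_ok_gt0 // mu0 /=.
(* As [mu e > 0], the condition on [nu] selects exactly one label, that of [l_(e:1)]. *)
under eq_bigr => l _ do rewrite (big_pred1 (Ordinal (mu0 e))) //.
set nu := Ordinal (mu0 e).
under eq_bigr => l _ do rewrite [_ * (mu e * lambda e)%:R]mulrC -!mulrA.
rewrite -big_distrr /=; congr (_ * _).
under eq_bigr => l _ do rewrite mulrA.
rewrite (sum_mixed_partial_omit comm_partial (fun s => lambda (tag s) : nat)) //=.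
congr (_ * _); apply/esym/jet_polar_perm => //; first exact: smooth_iter_x.
exact: perm_mult_parts_omit.
Qed.

End Assembly.

(* In (kappa.+1 - M)%N, M <= kappa + 1 so nothing is truncated; when
   M = kappa + 1 this factor kills the Y-term, whose order kappa - M
   is then irrelevant. *)
Theorem theorem4p18 (R : realType) (K : numFieldType)
    (hK : K = R :> numFieldType \/ K = R[i]%C :> numFieldType)
    (m : nat) (hm : (1 <= m)%N)
    (X : 'rV[K]_(1 + m) -> K) (Y : 'I_m -> 'rV[K]_(1 + m) -> K)
    (hX : smooth X) (hY : forall j, smooth (Y j))
    (kappa : nat) (hkappa : (1 <= kappa)%N) (j : 'I_m) (J : jet K m) :
  prolongation_coef X Y j kappa J =
    mixed_partial kappa [::] (Y j) (jet_base J)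
    + \sum_(1 <= d < kappa.+2)
      \sum_(lambda : {ffun 'I_d -> 'I_kappa.+1} | lambda_ok lambda)
      \sum_(mu : {ffun 'I_d -> 'I_kappa.+2} | mu_ok lambda mu)
      \sum_(l : {ffun {e : 'I_d & 'I_(mu e)} -> 'I_m})
        let M := weight lambda mu in
        (kappa ^_ M.-1)%:R
          / (\prod_(e < d) ((lambda e)`! ^ mu e * (mu e)`!))%N%:R
        * ((kappa.+1 - M)%N%:R
             * mixed_partial (kappa - M) [seq l s | s : {e : 'I_d & 'I_(mu e)}]
                 (Y j) (jet_base J)
           - \sum_(e < d) \sum_(nu < mu e | nu == 0%N :> nat)
               (l (label nu) == j)%:R * (mu e * lambda e)%N%:R
               * mixed_partial (kappa.+1 - M)
                   [seq l s | s : {e : 'I_d & 'I_(mu e)} in predC1 (label nu)]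
                   X (jet_base J))
        * \prod_(e < d) \prod_(nu < mu e) jet_y J (lambda e) (l (label nu)).
Proof.
(* The choice between [R] and [R[i]] enters only through the symmetry of second derivatives. *)
have comm : partials_commute K m.
  case: hK => [eK|eK]; subst K => f i k sf.
  - exact: (partialC (real_separated_id R)).
  - exact: (partialC (real_separated_complex R)).
rewrite (prolongation_coef_mults comm kappa hX hY) -sum_mults_of; congr (_ + _).
apply: eq_big_nat => d _; apply: eq_bigr => lambda okl; apply: eq_bigr => mu okm.
by rewrite -(sum_labels comm hX hY okl okm).
Qed.
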